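(* Let $g=\sum_{i=1}^{n}s_i$ be a disjunctive sum of $n$ non-empty BIPASS strips with $\Delta(g)=0$. If $n$ is odd, then: (1) $g\parallel 0$ (the first player wins $g$); and in particular, if each $s_i\equiv *$, then $g\equiv *$; (2) $\downarrow+*<g<\uparrow+*$; (3) $\downarrow\;\vartriangleleft\!\mid g\;\vartriangleleft\!\mid\;\uparrow$. If $n$ is even, then: (4) $g\parallel *$; and in particular, if each $s_i$ is a larvae, then $g\equiv 0$; (5) $\downarrow<g<\uparrow$; (6) $\downarrow+*\;\vartriangleleft\!\mid g\;\vartriangleleft\!\mid\;\uparrow+*$.
   Context: **BIPASS.** A strip is a finite word over $\{B,W\}$ ($B$ = black stone, $W$ = white stone). Dead stones are removed immediately: a white stone with no black stone to its left, and a black stone with no white stone to its right, are deleted. So a strip is either the empty word (the game $0$) or a word beginning with $B$ and ending with $W$. A Left move chooses a black stone at position $i$ and a white stone at position $j>i$ with no black stone strictly between them, and interchanges the two; a Right move chooses a black stone at position $i$ and a white stone at position $j>i$ with no white stone strictly between them, and interchanges the two. After a move, dead stones (all leading $W$'s and all trailing $B$'s) are deleted. Normal play: a player who cannot move loses. For a strip $s$, $\Delta(s)=w(s)-b(s)$ (number of white stones minus number of black stones), and $\Delta$ is additive over disjunctive sums of strips. A larvae is a strip of the form $BW^m$ with $m\ge 1$ (black headed) or $B^mW$ with $m\ge1$ (white headed). Games are compared in the usual partial order of normal-play games: $\equiv$ is equality of game values, $G\parallel H$ means $G$ and $H$ are incomparable (fuzzy), and $G\vartriangleleft\!\mid H$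 means $G<H$ or $G\parallel H$ (equivalently $G\not\ge H$). $*=\{0\mid 0\}$, $\uparrow=\{0\mid *\}$, $\downarrow=-\uparrow$. *)

(* Defs.v *)
From HB Require Import structures.
From mathcomp Require Import all_boot all_algebra zify.

Set Implicit Arguments.
Unset Strict Implicit.
Unset Printing Implicit Defensive.

(* Short (finite) combinatorial games: finite lists of Left options and of
   Right options. *)
Inductive game : Type := Game of seq game & seq game.

Definition left_options (G : game) : seq game := let: Game GL _ := G in GL.
Definition right_options (G : game) : seq game := let: Game _ GR := G in GR.

Definition gzero : game := Game [::] [::].

Fixpoint gneg (G : game) : game :=
  let: Game GL GR := G in Game (map gneg GR) (map gneg GL).

Fixpoint gadd (G : game) : game -> game :=
  fix gaddG (H : game) : game :=
    let: Game GL GR := G in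
    let: Game HL HR := H in
    Game (map (fun gl => gadd gl H) GL ++ map gaddG HL)
         (map (fun gr => gadd gr H) GR ++ map gaddG HR).

(* gcmp G H computes the pair (G <= H, H <= G); the two relations are computed
   together so that Conway's recursive definition (lemma gleE) is structural. *)
Fixpoint gcmp (G : game) : game -> bool * bool :=
  fix gcmpG (H : game) : bool * bool :=
    let: Game GL GR := G in
    let: Game HL HR := H in
    (all (fun gl => ~~ (gcmp gl H).2) GL && all (fun hr => ~~ (gcmpG hr).2) HR,
     all (fun hl => ~~ (gcmpG hl).1) HL && all (fun gr => ~~ (gcmp gr H).1) GR).

Definition gle (G H : game) : bool := (gcmp G H).1.
Definition geqv (G H : game) : bool := gle G H && gle H G.
Definition glt (G H : game) : bool := gle G H && ~~ gle H G.
Definition gfuzzy (G H : game) : bool := ~~ gle G H && ~~ gle H G.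
Definition glt_fuzzy (G H : game) : bool := glt G H || gfuzzy G H.

(* wins_first G = (Left wins G moving first, Right wins G moving first), under
   normal play: a player who has no option loses. *)
Fixpoint wins_first (G : game) : bool * bool :=
  let: Game GL GR := G in
  (has (fun gl => ~~ (wins_first gl).2) GL,
   has (fun gr => ~~ (wins_first gr).1) GR).
Definition first_player_wins (G : game) : bool :=
  (wins_first G).1 && (wins_first G).2.

Definition gstar : game := Game [:: gzero] [:: gzero].
Definition gup : game := Game [:: gzero] [:: gstar].
Definition gdown : game := gneg gup.

Lemma gaddE (G H : game) :
  gadd G H = Game (map (gadd^~ H) (left_options G) ++ map (gadd G) (left_options H))
                  (map (gadd^~ H) (right_options G) ++ map (gadd G) (right_options H)).
Proof. by case: G H => GL GR [HL HR]. Qed.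

Fixpoint all_prop (P : game -> Prop) (s : seq game) : Prop :=
  if s is x :: s' then P x /\ all_prop P s' else True.

Fixpoint game_rect_all (P : game -> Prop)
    (IH : forall GL GR, all_prop P GL -> all_prop P GR -> P (Game GL GR))
    (G : game) : P G :=
  let fix aux (s : seq game) : all_prop P s :=
    if s is x :: s' then conj (game_rect_all IH x) (aux s') else I in
  let: Game GL GR := G in IH GL GR (aux GL) (aux GR).

Lemma all_prop_eq (p q : pred game) (s : seq game) :
  all_prop (fun x => p x = q x) s -> all p s = all q s.
Proof. by elim: s => //= x s IHs [-> /IHs ->]. Qed.

Lemma all_prop_sub (P Q : game -> Prop) (s : seq game) :
  (forall x, P x -> Q x) -> all_prop P s -> all_prop Q s.
Proof. by move=> PQ; elim: s => //= x s IHs [/PQ ? /IHs ?]. Qed.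

Lemma gcmpC (G H : game) : gcmp G H = ((gcmp H G).2, (gcmp H G).1).
Proof.
elim/game_rect_all: G H => GL GR IHL IHR.
elim/game_rect_all=> HL HR JHL JHR /=.
congr (_ && _, _ && _); apply: all_prop_eq.
- by apply: all_prop_sub IHL => x /= Ex;
  exact: (congr1 (fun p : bool * bool => ~~ p.2) (Ex (Game HL HR))).
- by apply: all_prop_sub JHR => x /= Ex;
  exact: (congr1 (fun p : bool * bool => ~~ p.2) Ex).
- by apply: all_prop_sub JHL => x /= Ex;
  exact: (congr1 (fun p : bool * bool => ~~ p.1) Ex).
- by apply: all_prop_sub IHR => x /= Ex;
  exact: (congr1 (fun p : bool * bool => ~~ p.1) (Ex (Game HL HR))).
Qed.

(* Conway's definition: G <= H iff no G^L >= H and no H^R <= G. *)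
Lemma gleE (G H : game) :
  gle G H = all (fun gl => ~~ gle H gl) (left_options G)
            && all (fun hr => ~~ gle hr G) (right_options H).
Proof.
rewrite /gle; case: G H => GL GR [HL HR].
transitivity (all (fun gl => ~~ (gcmp gl (Game HL HR)).2) GL
  && all (fun hr => ~~ (gcmp (Game GL GR) hr).2) HR) => //.
by congr andb; apply: eq_all => x; rewrite gcmpC.
Qed.

Inductive stone : Type := Black | White.

Definition is_black (x : stone) : bool := if x is Black then true else false.
Definition stone_of_bool (b : bool) : stone := if b then Black else White.
Lemma is_blackK : cancel is_black stone_of_bool. Proof. by case. Qed.
HB.instance Definition _ := Equality.copy stone (can_type is_blackK).

Definition is_strip (s : seq stone) : bool :=
  (s == [::]) || ((head White s == Black) && (last Black s == White)).

(* Deletion of the dead stones: all leading W's and all trailing B's. *)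
Definition remove_dead (s : seq stone) : seq stone :=
  let s1 := drop (find (pred1 Black) s) s in
  rev (drop (find (pred1 White) (rev s1)) (rev s1)).

Definition swap_stones (s : seq stone) (i j : nat) : seq stone :=
  set_nth White (set_nth White s i (nth White s j)) j (nth White s i).

(* No stone of colour c lies strictly between a black stone at i and a white
   stone at j > i. *)
Definition legal_swap (c : stone) (s : seq stone) (i j : nat) : bool :=
  [&& i < j < size s, nth White s i == Black, nth White s j == White
    & all (fun k => nth White s k != c) (index_iota i.+1 j)].

Definition bipass_moves (c : stone) (s : seq stone) : seq (seq stone) :=
  [seq remove_dead (swap_stones s i j)
     | i <- iota 0 (size s), j <- [seq j <- iota 0 (size s) | legal_swap c s i j]].

Definition left_moves : seq stone -> seq (seq stone) := bipass_moves Black.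
Definition right_moves : seq stone -> seq (seq stone) := bipass_moves White.

(* Number of pairs (i, j), i < j, with a black stone at i and a white stone at
   j; it decreases at every move, hence bounds the length of play. *)
Fixpoint inversions (s : seq stone) : nat :=
  if s is x :: s' then (x == Black) * count_mem White s' + inversions s' else 0.

Fixpoint strip_game_rec (n : nat) (s : seq stone) : game :=
  if n is n'.+1 then Game (map (strip_game_rec n') (left_moves s))
                          (map (strip_game_rec n') (right_moves s))
  else gzero.

(* The game of a strip; lemma strip_gameE is its defining recursion. *)
Definition strip_game (s : seq stone) : game := strip_game_rec (inversions s) s.

Lemma inversions_cat (s t : seq stone) :
  inversions (s ++ t)
  = inversions s + count_mem Black s * count_mem White t + inversions t.
Proof.
elim: s => //= x s ->; rewrite count_cat mulnDr mulnDl -!addnA.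
by congr (_ + _); rewrite addnCA; congr (_ + _); rewrite addnCA.
Qed.

Lemma drop_findK (c d : stone) (s : seq stone) : c != d ->
  exists k, s = nseq k c ++ drop (find (pred1 d) s) s.
Proof.
move=> cd; elim: s => [|x s [k IHs]]; first by exists 0.
rewrite /=; case: (eqVneq x d) => [|xd]; first by exists 0.
by exists k.+1; rewrite /= -IHs; case: c d x cd xd {IHs} => [] [] [].
Qed.

Lemma remove_deadK (s : seq stone) :
  exists k l, s = nseq k White ++ remove_dead s ++ nseq l Black.
Proof.
have [k Ek] := @drop_findK White Black s isT.
pose s1 := drop (find (pred1 Black) s) s.
have [l El] := @drop_findK Black White (rev s1) isT.
exists k, l; rewrite {1}Ek; congr (_ ++ _).
by rewrite -[LHS]revK {1}El rev_cat rev_nseq.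
Qed.

Lemma inversions_remove_dead (s : seq stone) :
  inversions (remove_dead s) = inversions s.
Proof.
have [k [l {2}->]] := remove_deadK s.
have inv0 c m : inversions (nseq m c) = 0.
  by elim: m => //= m ->; rewrite count_nseq; case: c.
by rewrite !inversions_cat !inv0 !count_nseq /= !mul0n muln0 !addn0.
Qed.

Lemma set_nth_cat_cons (a t : seq stone) (x y : stone) :
  set_nth White (a ++ x :: t) (size a) y = a ++ y :: t.
Proof. by elim: a => //= z a ->. Qed.

Lemma inversions_move (c : stone) (s t : seq stone) :
  t \in bipass_moves c s -> inversions t < inversions s.
Proof.
case/allpairsPdep=> i [j [_]]; rewrite mem_filter => /andP[+ _ ->].
case/and4P=> /andP[ij js] /eqP si /eqP sj _.
rewrite inversions_remove_dead /swap_stones si sj.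
have is_ := ltn_trans ij js.
pose a := take i s; pose u := drop i.+1 s.
pose m := take (j - i.+1) u; pose e := drop (j - i.+1).+1 u.
have sza : size a = i by rewrite size_takel // ltnW.
have szu : size u = size s - i.+1 by rewrite size_drop.
have szm : size m = j - i.+1.
  by rewrite size_takel // szu leq_sub2r // ltnW.
have ju : j - i.+1 < size u by rewrite szu ltn_sub2r // (leq_ltn_trans ij).
have Es : s = a ++ Black :: m ++ White :: e.
  rewrite -[LHS](cat_take_drop i) -/a (drop_nth White) // si -/u.
  rewrite -[u in LHS](cat_take_drop (j - i.+1)) -/m (drop_nth White) // -/e.
  by rewrite nth_drop subnKC // sj.
have -> : set_nth White (set_nth White s i White) j Black
    = a ++ White :: m ++ Black :: e.
  rewrite Es -sza set_nth_cat_cons -cat_rcons catA.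
  have -> : j = size (rcons a White ++ m).
    by rewrite size_cat size_rcons sza szm subnKC.
  by rewrite set_nth_cat_cons -catA cat_rcons.
rewrite {}Es !inversions_cat /= !inversions_cat /= !count_cat /=.
rewrite !(mul0n, mul1n, add0n, addn0).
set A := inversions a; set B := count_mem Black a; set M := inversions m.
set W := count_mem White m; set N := count_mem Black m.
set V := count_mem White e; set E := inversions e.
nia.
Qed.

Lemma strip_game_recE (n : nat) (s : seq stone) :
  inversions s <= n -> strip_game_rec n s = strip_game s.
Proof.
rewrite /strip_game.
have [k] := ubnP (inversions s); elim: k s n => // k IHk s n sk sn.
have noinv0 c t m : t \in bipass_moves c s -> inversions s <= m.+1 ->
    strip_game_rec m t = strip_game_rec (inversions t) t.
  move=> /inversions_move ts sm; apply: IHk; first exact: leq_trans ts sk.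
  by rewrite -ltnS (leq_trans ts).
case Es: (inversions s) sn => [|p].
  have nomove c : bipass_moves c s = [::].
    case E: (bipass_moves c s) => [//|t r].
    by have := @inversions_move c s t; rewrite E mem_head Es => /(_ isT).
  by case: n => //= n _; rewrite /left_moves /right_moves !nomove.
case: n => // n pn /=.
by congr Game; apply/eq_in_map => t ts;
   rewrite (noinv0 _ _ _ ts) ?Es // (noinv0 _ _ p ts) ?Es.
Qed.

Lemma strip_gameE (s : seq stone) :
  strip_game s = Game (map strip_game (left_moves s)) (map strip_game (right_moves s)).
Proof.
rewrite -(strip_game_recE (leqnSn _)) /=.
by congr Game; apply/eq_in_map => t /inversions_move /ltnW /strip_game_recE.
Qed.

Lemma drop_find_head (d : stone) (s : seq stone) (x : stone) (r : seq stone) :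
  drop (find (pred1 d) s) s = x :: r -> x = d.
Proof. by elim: s => //= y s IHs; case: (eqVneq y d) => // -> [->]. Qed.

Lemma remove_dead_strip (s : seq stone) : is_strip (remove_dead s).
Proof.
rewrite /remove_dead; set s1 := drop _ s.
case E: (drop _ (rev s1)) => [//|x r].
have Ex := drop_find_head E; case E1: s1 E => [//|y t].
have Ey := drop_find_head E1; set k := find _ _ => E.
have El : last x r = y.
  by rewrite -[LHS](last_cat White (take k (rev (y :: t))) (x :: r)) -E
             cat_take_drop rev_cons last_rcons.
apply/orP; right; rewrite rev_cons last_rcons Ex eqxx andbT.
by rewrite -rev_cons -Ex lastI El rev_rcons Ey.
Qed.

Definition gsum (n : nat) (G : 'I_n -> game) : game :=
  \big[gadd/gzero]_(i < n) G i.

Definition Delta (s : seq stone) : int :=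
  ((count_mem White s)%:Z - (count_mem Black s)%:Z)%R.

Definition is_larvae (s : seq stone) : Prop :=
  exists2 m : nat, 1 <= m
    & s = Black :: nseq m White \/ s = rcons (nseq m Black) White.

(* Main.v *)
From HB Require Import structures.
Require Import Defs.
From mathcomp Require Import all_boot all_order all_algebra zify.
From Stdlib Require List.

(** Every comparison in the theorem is the outcome of one sum of strips.
    Indeed G <= H exactly when Left, moving first, loses G - H, and the games
    to compare with are themselves strips up to equality: BW is *, BBW is
    down and BWW is up. So it is enough to know who wins a sum of strips whose
    total Delta is small, and by reflection (reverse a strip and exchange the
    colours) it is enough to know when Right wins.

    The relevant data of a position are its total Delta D and the parity of the
    number of its live, that is non-empty, strips. Put e = 1 if that number is
    odd and e = 0 if it is even. Then
    - Right moving first wins if D < e;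
    - Right moving second wins if D + 1 < e.
    The two claims feed each other. A Left move raises D by at most 1, and if
    it empties a strip, which changes e, it does not raise D at all
    ([left_move_Delta]); this leads from the second condition to the first. In
    the other direction, in a strip with at least two white stones Right brings
    the leftmost white stone to the front, where it dies: D drops by one and e
    stays. If no such strip exists, all live strips have the form B^m W, so
    every term of D is nonpositive. If D < 0, some m is at least 2, and Right
    can choose to replace that strip by BW or by nothing: both have Delta 0, so
    this choice repairs the parity. If D = 0, an odd number of strips BW is
    left and Right removes one.

    These last replies may reach a position with D = 0 and e = 0, outside the two
    conditions. All its strips are larvae then, and an even number of larvae
    with D = 0 is a win for the second player: if Left makes a larva B^m W one
    shorter, then D = 1, some B W^k has k >= 2, and Right makes it one shorter.
    Adding this case to the second condition and its successor D = 1 to the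
    first closes the induction ([after_left_move], [right_has_good_move]), and
    it also gives the equalities with 0 and with *. *)

Set Implicit Arguments.
Unset Strict Implicit.
Unset Printing Implicit Defensive.

Import Order.TTheory GRing.Theory Num.Theory.

(** * Comparison and addition of short games *)

Lemma allIn (p : pred game) (s : seq game) :
  all p s <-> forall x, List.In x s -> p x.
Proof.
elim: s => //= y s [IH1 IH2]; split=> [/andP[py /IH1 ps] x [<- //|]|ps].
  exact: ps.
by rewrite ps /=; [apply: IH2 => x xs; apply: ps; right | left].
Qed.

Lemma game_ind_options (P : game -> Prop) :
  (forall G, (forall x, List.In x (left_options G) -> P x) ->
             (forall x, List.In x (right_options G) -> P x) -> P G) ->
  forall G, P G.
Proof.
have sub s : all_prop P s -> forall x, List.In x s -> P x.
  by elim: s => //= y s IHs [Py /IHs Ps] x [<- //|]; apply: Ps.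
by move=> IH; elim/game_rect_all=> GL GR /sub PL /sub PR; apply: IH.
Qed.

Lemma gleP (G H : game) :
  gle G H <-> (forall x, List.In x (left_options G) -> ~~ gle H x) /\
              (forall x, List.In x (right_options H) -> ~~ gle x G).
Proof.
rewrite gleE; split=> [/andP[/allIn ? /allIn ?] //|[? ?]].
by apply/andP; split; apply/allIn.
Qed.

Lemma gle_refl : reflexive gle.
Proof.
elim/game_ind_options=> G IHL IHR; apply/gleP.
split=> x xG; apply/negP => /gleP[hL hR].
  by have := hL _ xG; rewrite IHL.
by have := hR _ xG; rewrite IHR.
Qed.

(** Transitivity for G, H, K at an option of one of them calls for transitivity
    in a cyclically rotated order, so the three rotations are proved together. *)
Lemma gle_trans_rot (G H K : game) :
  [/\ gle G H -> gle H K -> gle G K, gle H K -> gle K G -> gle H G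
    & gle K G -> gle G H -> gle K H].
Proof.
elim/game_ind_options: G H K => G IGL IGR; elim/game_ind_options=> H IHL IHR.
elim/game_ind_options=> K IKL IKR.
split=> /[dup] le1 /gleP[le1L le1R] /[dup] le2 /gleP[le2L le2R];
  apply/gleP; split=> x xP; apply/negP => le3.
- by have [_ /(_ le2 le3) le4 _] := IGL x xP H K; have := le1L x xP; rewrite le4.
- by have [_ _ /(_ le3 le1) le4] := IKR x xP; have := le2R x xP; rewrite le4.
- by have [_ _ /(_ le2 le3) le4] := IHL x xP K; have := le1L x xP; rewrite le4.
- by have [/(_ le3 le1) le4 _ _] := IGR x xP H K; have := le2R x xP; rewrite le4.
- by have [/(_ le2 le3) le4 _ _] := IKL x xP; have := le1L x xP; rewrite le4.
- by have [_ /(_ le3 le1) le4 _] := IHR x xP K; have := le2R x xP; rewrite le4.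
Qed.

Lemma gle_trans : transitive gle.
Proof. by move=> H G K; have [] := gle_trans_rot G H K. Qed.

(** If G <= H failed through H <= x for a Left option x of G, then x <= y would
    give H <= y for a Left option y of H, which is impossible. This compares
    games whose option lists agree only up to order and equality of values. *)
Lemma gle_options (G H : game) :
  (forall x, List.In x (left_options G) ->
     exists2 y, List.In y (left_options H) & gle x y) ->
  (forall y, List.In y (right_options H) ->
     exists2 x, List.In x (right_options G) & gle x y) ->
  gle G H.
Proof.
move=> hL hR; apply/gleP; split=> x xP; apply/negP => le1.
  have [y yP xy] := hL x xP; have /gleP[/(_ y yP) /negP[]] := gle_trans le1 xy.
  exact: gle_refl.
have [y yP yx] := hR x xP; have /gleP[_ /(_ y yP) /negP[]] := gle_trans yx le1.
exact: gle_refl.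
Qed.

Lemma eq_map_In (f h : game -> game) (s : seq game) :
  (forall x, List.In x s -> f x = h x) -> map f s = map h s.
Proof.
elim: s => //= x s IHs fh; rewrite fh; last by left.
by rewrite IHs // => y ys; apply: fh; right.
Qed.

Lemma gadd0g : left_id gzero gadd.
Proof.
elim/game_ind_options=> G IHL IHR; rewrite gaddE /=.
by rewrite (eq_map_In IHL) (eq_map_In IHR) !map_id; case: G {IHL IHR}.
Qed.

Lemma gaddg0 : right_id gzero gadd.
Proof.
elim/game_ind_options=> G IHL IHR; rewrite gaddE /= !cats0.
by rewrite (eq_map_In IHL) (eq_map_In IHR) !map_id; case: G {IHL IHR}.
Qed.

Lemma left_optionsD (G H : game) :
  left_options (gadd G H)
  = map (gadd^~ H) (left_options G) ++ map (gadd G) (left_options H).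
Proof. by rewrite gaddE. Qed.

Lemma right_optionsD (G H : game) :
  right_options (gadd G H)
  = map (gadd^~ H) (right_options G) ++ map (gadd G) (right_options H).
Proof. by rewrite gaddE. Qed.

(** The option lists of both sides are concatenated in the same order, so this
    is an identity of games and not only of values. *)
Lemma gaddA : associative gadd.
Proof.
elim/game_ind_options=> G IGL IGR; elim/game_ind_options=> H IHL IHR.
elim/game_ind_options=> K IKL IKR.
rewrite (gaddE G (gadd H K)) (gaddE (gadd G H) K) !left_optionsD !right_optionsD.
rewrite !map_cat -!map_comp -!catA.
by congr (Game (_ ++ _ ++ _) (_ ++ _ ++ _)); apply: eq_map_In => x xP /=;
  first [exact: IGL | exact: IGR | exact: IHL | exact: IHR | exact: IKL | exact: IKR].
Qed.

HB.instance Definition _ := Monoid.isLaw.Build game gzero gadd gaddA gadd0g gaddg0.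

Lemma eq_all_In (p q : pred game) (s : seq game) :
  (forall x, List.In x s -> p x = q x) -> all p s = all q s.
Proof.
elim: s => //= x s IHs pq; rewrite pq; last by left.
by rewrite IHs // => y ys; apply: pq; right.
Qed.

(** The Left options of G - H are x - H and G - y, for x a Left option of G and
    y a Right option of H: these are the games from which G <= H is defined, so
    the two recursions coincide. *)
Lemma gle_sub (G H : game) :
  gle (gadd G (gneg H)) gzero = gle G H /\ gle gzero (gadd G (gneg H)) = gle H G.
Proof.
elim/game_ind_options: G H => G IGL IGR.
elim/game_ind_options=> H IHL IHR.
have [negL negR]: left_options (gneg H) = map gneg (right_options H)
  /\ right_options (gneg H) = map gneg (left_options H) by case: H {IHL IHR}.
rewrite !(gleE _ gzero) !(gleE gzero) !gaddE /= !all_cat negL negR !all_map !andbT.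
rewrite (gleE G) (gleE H); split; last rewrite andbC.
all: congr andb; apply: eq_all_In => x xP /=; congr negb.
- by case: (IGL x xP H).
- by case: (IHR x xP).
- by case: (IHL x xP).
- by case: (IGR x xP H).
Qed.

Lemma In_left_optionsD (x G H : game) :
  List.In x (left_options (gadd G H)) <->
  (exists2 y, List.In y (left_options G) & x = gadd y H) \/
  (exists2 y, List.In y (left_options H) & x = gadd G y).
Proof.
rewrite left_optionsD List.in_app_iff !List.in_map_iff.
by split=> -[] [y] => [[<- yG]|[<- yH]|yG ->|yH ->];
   [left | right | left | right]; exists y.
Qed.

Lemma In_right_optionsD (x G H : game) :
  List.In x (right_options (gadd G H)) <->
  (exists2 y, List.In y (right_options G) & x = gadd y H) \/
  (exists2 y, List.In y (right_options H) & x = gadd G y).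
Proof.
rewrite right_optionsD List.in_app_iff !List.in_map_iff.
by split=> -[] [y] => [[<- yG]|[<- yH]|yG ->|yH ->];
   [left | right | left | right]; exists y.
Qed.

Lemma gle_addC (G H : game) : gle (gadd G H) (gadd H G).
Proof.
elim/game_ind_options: G H => G IGL IGR; elim/game_ind_options=> H IHL IHR.
apply/gleP; split=> x; [case/In_left_optionsD | case/In_right_optionsD];
  case=> y yP ->; apply/negP => /gleP[leL leR].
- have /leL/negP[]: List.In (gadd H y) (left_options (gadd H G)).
    by apply/In_left_optionsD; right; exists y.
  exact: IGL.
- have /leL/negP[]: List.In (gadd y G) (left_options (gadd H G)).
    by apply/In_left_optionsD; left; exists y.
  exact: IHL.
- have /leR/negP[]: List.In (gadd G y) (right_options (gadd G H)).
    by apply/In_right_optionsD; right; exists y.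
  exact: IHR.
- have /leR/negP[]: List.In (gadd y H) (right_options (gadd G H)).
    by apply/In_right_optionsD; left; exists y.
  exact: IGR.
Qed.

(** An option of K moves both sides at once and leaves the comparison of G with
    H as it was, so such options never refute G + K <= H + K when G <= H. *)
Lemma gle_add2r_step (G H K : game) :
  (forall x, List.In x (left_options G) -> gle (gadd H K) (gadd x K) = gle H x) ->
  (forall x, List.In x (right_options H) -> gle (gadd x K) (gadd G K) = gle x G) ->
  (forall y, List.In y (left_options K) -> gle (gadd G y) (gadd H y) = gle G H) ->
  (forall y, List.In y (right_options K) -> gle (gadd G y) (gadd H y) = gle G H) ->
  gle (gadd G K) (gadd H K) = gle G H.
Proof.
move=> IG IH IKL IKR.
apply/idP/idP => [/gleP[leL leR]|/[dup] leGH /gleP[leL leR]]; apply/gleP.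
  split=> x xP.
    by rewrite -IG //; apply/leL/In_left_optionsD; left; exists x.
  by rewrite -IH //; apply/leR/In_right_optionsD; left; exists x.
split=> x; [case/In_left_optionsD | case/In_right_optionsD] => -[y yP ->].
- by rewrite IG // leL.
- apply/negP => /gleP[le _].
  have /le: List.In (gadd H y) (left_options (gadd H K)).
    by apply/In_left_optionsD; right; exists y.
  by rewrite IKL // leGH.
- by rewrite IH // leR.
- apply/negP => /gleP[_ le].
  have /le: List.In (gadd G y) (right_options (gadd G K)).
    by apply/In_right_optionsD; right; exists y.
  by rewrite IKR // leGH.
Qed.

(** The induction goes through comparisons in both directions, since the
    definition of the order exchanges its arguments. *)
Lemma gle_add2r (K G H : game) : gle (gadd G K) (gadd H K) = gle G H.
Proof.
suff [] : gle (gadd G K) (gadd H K) = gle G H /\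
          gle (gadd H K) (gadd G K) = gle H G by [].
elim/game_ind_options: G H K => G IGL IGR.
elim/game_ind_options=> H IHL IHR; elim/game_ind_options=> K IKL IKR.
split; apply: gle_add2r_step => x xP.
- by case: (IGL x xP H K).
- by case: (IHR x xP K).
- by case: (IKL x xP).
- by case: (IKR x xP).
- by case: (IHL x xP K).
- by case: (IGR x xP H K).
- by case: (IKL x xP).
- by case: (IKR x xP).
Qed.

Lemma gle_add (G H G' H' : game) :
  gle G H -> gle G' H' -> gle (gadd G G') (gadd H H').
Proof.
move=> leGH leGH'; have: gle (gadd G G') (gadd H G') by rewrite gle_add2r.
move/gle_trans; apply; apply: gle_trans (gle_addC _ _) _.
by apply: gle_trans (gle_addC _ _); rewrite gle_add2r.
Qed.

Lemma geqv_add (G H G' H' : game) :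
  geqv G H -> geqv G' H' -> geqv (gadd G G') (gadd H H').
Proof. by case/andP=> ? ? /andP[? ?]; apply/andP; split; apply: gle_add. Qed.

Lemma geqv_trans : transitive geqv.
Proof.
move=> H G K /andP[GH HG] /andP[HK KH].
by apply/andP; split; [apply: gle_trans GH HK | apply: gle_trans KH HG].
Qed.

Lemma geqv_gle0 (G H : game) :
  geqv G H -> gle G gzero = gle H gzero /\ gle gzero G = gle gzero H.
Proof.
case/andP=> leGH leHG; split; apply/idP/idP.
- exact: gle_trans.
- exact: gle_trans.
- by move=> le0; apply: gle_trans le0 leGH.
- by move=> le0; apply: gle_trans le0 leHG.
Qed.

(** This connects the order with play: G <= 0 says that Left loses when moving
    first. *)
Lemma wins_firstE (G : game) : wins_first G = (~~ gle G gzero, ~~ gle gzero G).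
Proof.
elim/game_ind_options: G => -[GL GR] /= IHL IHR.
rewrite (gleE _ gzero) (gleE gzero) /= andbT -!has_predC.
have eq_has_In (p q : pred game) s :
    (forall x, List.In x s -> p x = q x) -> has p s = has q s.
  by move=> pq; apply: negb_inj; rewrite -!all_predC; apply: eq_all_In => x /pq /= ->.
by congr pair; apply: eq_has_In => x xP /=; [rewrite IHL | rewrite IHR].
Qed.

Lemma gneg_add (G H : game) : gneg (gadd G H) = gadd (gneg G) (gneg H).
Proof.
have negL K : left_options (gneg K) = map gneg (right_options K) by case: K.
have negR K : right_options (gneg K) = map gneg (left_options K) by case: K.
elim/game_ind_options: G H => G IGL IGR; elim/game_ind_options=> H IHL IHR.
rewrite (gaddE (gneg G)) !negL !negR gaddE /= !map_cat -!map_comp.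
by congr (Game (_ ++ _) (_ ++ _)); apply: eq_map_In => x xP /=;
  [apply: IGR | apply: IHR | apply: IGL | apply: IHL].
Qed.

Lemma gle_neg0 (G : game) :
  gle (gneg G) gzero = gle gzero G /\ gle gzero (gneg G) = gle G gzero.
Proof. by have := gle_sub gzero G; rewrite gadd0g. Qed.

Lemma glt_fuzzyE (G H : game) : glt_fuzzy G H = ~~ gle H G.
Proof. by rewrite /glt_fuzzy /glt /gfuzzy -andb_orl orbN. Qed.

(** * Strips and their moves *)

Lemma drop_find_nseq (c d : stone) (k : nat) (u : seq stone) :
  c != d -> head d u = d ->
  drop (find (pred1 d) (nseq k c ++ u)) (nseq k c ++ u) = u.
Proof.
move=> cd hu; elim: k => [|k IHk] /=; last by rewrite (negbTE cd).
by case: u hu => //= x u ->; rewrite eqxx.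
Qed.

(** Dead stones around a strip disappear whatever their number, and a strip has
    none of its own; all moves below are computed with this. *)
Lemma remove_deadE (k l : nat) (r : seq stone) :
  is_strip r -> remove_dead (nseq k White ++ r ++ nseq l Black) = r.
Proof.
move=> /orP r_strip; rewrite /remove_dead drop_find_nseq //; last first.
  by case: r r_strip => [_|x r [//|/andP[/eqP]]] //; case: l.
rewrite rev_cat rev_nseq drop_find_nseq ?revK //.
case/lastP: r r_strip => // r x [/eqP|/andP[_]]; first by case: r.
by rewrite last_rcons rev_rcons => /eqP.
Qed.

(** Factorised words replace indices, so that reflection acts on moves by
    reversing each factor. *)
Lemma bipass_movesP (c : stone) (s t : seq stone) :
  t \in bipass_moves c s <->
  exists a m e, [/\ s = a ++ Black :: m ++ White :: e, c \notin m
                  & t = remove_dead (a ++ White :: m ++ Black :: e)].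
Proof.
split=> [/allpairsPdep[i [j [_]]]|[a [m [e [-> cm ->]]]]].
  rewrite mem_filter => /andP[/and4P[/andP[ij js] /eqP si /eqP sj /allP cm] _ ->].
  have [Es Em]: s = take i s ++ Black :: take (j - i.+1) (drop i.+1 s)
                  ++ White :: drop j.+1 s /\
      size (take (j - i.+1) (drop i.+1 s)) = j - i.+1.
    split; last by rewrite size_takel // size_drop; lia.
    rewrite -[LHS](cat_take_drop i) (drop_nth White) ?si; last by lia.
    congr (_ ++ _ :: _); rewrite -[LHS](cat_take_drop (j - i.+1)).
    have -> : drop (j - i.+1) (drop i.+1 s) = drop j s.
      by rewrite drop_drop; congr drop; lia.
    by rewrite (drop_nth White js) sj.
  have Ei : size (take i s) = i by rewrite size_takel; lia.
  move: (take _ s) (take _ (drop _ _)) (drop j.+1 s) Es Em Ei => a m e Es Em Ei.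
  exists a, m, e; split => //.
    apply/negP => /(nthP White)[k km Ek]; rewrite Em in km.
    have /cm : i.+1 + k \in index_iota i.+1 j by rewrite mem_index_iota; lia.
    rewrite Es nth_cat Ei ifN; last by lia.
    have -> : i.+1 + k - i = k.+1 by lia.
    by rewrite /= nth_cat Em km Ek eqxx.
  rewrite /swap_stones si sj Es -Ei set_nth_cat_cons -cat_rcons catA.
  have -> : j = size (rcons a White ++ m) by rewrite size_cat size_rcons; lia.
  by rewrite set_nth_cat_cons -catA cat_rcons.
apply/allpairsPdep; exists (size a), (size a + (size m).+1).
have nth_a x u : nth White (a ++ x :: u) (size a) = x by rewrite nth_cat ltnn subnn.
have nth_m x u : nth White (a ++ x) (size a + u) = nth White x u.
  by rewrite nth_cat ifN ?addKn //; lia.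
have nth_e x : nth White (x :: m ++ White :: e) (size m).+1 = White.
  by rewrite /= nth_cat ltnn subnn.
split; first by rewrite mem_iota size_cat /=; lia.
  rewrite mem_filter mem_iota /legal_swap nth_a nth_m nth_e !eqxx /=.
  rewrite !size_cat /= size_cat /= -?andbA; apply/and4P; split; try lia.
  apply/allP => k; rewrite mem_index_iota => /andP[ak ke].
  have [i -> im]: exists2 i, k = size a + i.+1 & i < size m.
    by exists (k - (size a).+1); lia.
  rewrite nth_m /= nth_cat im; apply: contra cm => /eqP <-; exact: mem_nth.
symmetry; rewrite /swap_stones nth_a nth_m nth_e set_nth_cat_cons -cat_rcons catA.
have -> : size a + (size m).+1 = size (rcons a White ++ m).
  by rewrite size_cat size_rcons; lia.
by rewrite set_nth_cat_cons -catA cat_rcons.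
Qed.

Definition opposite (c : stone) : stone := if c is Black then White else Black.

Definition mirror (s : seq stone) : seq stone := rev (map opposite s).

Lemma oppositeK : involutive opposite. Proof. by case. Qed.

Lemma mirrorK : involutive mirror.
Proof. by move=> s; rewrite /mirror map_rev revK (mapK oppositeK). Qed.

Lemma mirror_cat (s t : seq stone) : mirror (s ++ t) = mirror t ++ mirror s.
Proof. by rewrite /mirror map_cat rev_cat. Qed.

Lemma mirror_cons (x : stone) (s : seq stone) :
  mirror (x :: s) = mirror s ++ [:: opposite x].
Proof. by rewrite -cat1s mirror_cat. Qed.

Lemma mirror_nseq (k : nat) (c : stone) : mirror (nseq k c) = nseq k (opposite c).
Proof. by rewrite /mirror map_nseq rev_nseq. Qed.

Lemma mirror_is_strip (s : seq stone) : is_strip s -> is_strip (mirror s).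
Proof.
case: s => // x s; rewrite /is_strip /= => /andP[/eqP ->].
case/lastP: s => // s y; rewrite last_rcons => /eqP ->.
by rewrite /mirror /= map_rcons rev_cons rev_rcons /= last_rcons.
Qed.

Lemma mirror_nilE (s : seq stone) : (mirror s == [::]) = (s == [::]).
Proof. by rewrite -!size_eq0 size_rev size_map. Qed.

Lemma remove_dead_mirror (s : seq stone) : remove_dead (mirror s) = mirror (remove_dead s).
Proof.
have [k [l {1}->]] := remove_deadK s.
rewrite !mirror_cat !mirror_nseq -catA remove_deadE //.
exact/mirror_is_strip/remove_dead_strip.
Qed.

Lemma count_mirror (c : stone) (s : seq stone) :
  count_mem c (mirror s) = count_mem (opposite c) s.
Proof. by rewrite count_rev count_map; apply: eq_count => -[]; case: c. Qed.

Lemma Delta_mirror (s : seq stone) : Delta (mirror s) = (- Delta s)%R.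
Proof. by rewrite /Delta !count_mirror /= opprB. Qed.

Lemma mirror_larvae (s : seq stone) : is_larvae s -> is_larvae (mirror s).
Proof.
case=> m m1 [->|->]; exists m => //.
  by right; rewrite mirror_cons mirror_nseq cats1.
by left; rewrite -cats1 mirror_cat mirror_nseq.
Qed.

Lemma mirror_moves (c : stone) (s t : seq stone) :
  t \in bipass_moves c s -> mirror t \in bipass_moves (opposite c) (mirror s).
Proof.
case/bipass_movesP=> a [m [e [-> cm ->]]]; apply/bipass_movesP.
exists (mirror e), (mirror m), (mirror a); split.
- by rewrite mirror_cat !mirror_cons mirror_cat mirror_cons -!catA.
- rewrite mem_rev; apply: contra cm => /mapP[x xm] /(congr1 opposite).
  by rewrite !oppositeK => ->.
- by rewrite -remove_dead_mirror mirror_cat !mirror_cons mirror_cat mirror_cons -!catA.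
Qed.

Lemma In_map_mem (f : seq stone -> game) (x : game) (l : seq (seq stone)) :
  List.In x (map f l) <-> exists2 t, t \in l & x = f t.
Proof.
elim: l => [|y l IHl] /=; first by split=> // -[].
rewrite IHl; split=> [[<-|[t tl ->]]|[t]].
- by exists y; rewrite // mem_head.
- by exists t; rewrite // inE tl orbT.
- by rewrite inE => /orP[/eqP -> ->|tl ->]; [left | right; exists t].
Qed.

(** Reflection exchanges the roles of the players; the options of the two games
    correspond but are listed in different orders, so they are equal only as
    values. *)
Lemma strip_game_mirror (s : seq stone) :
  geqv (strip_game (mirror s)) (gneg (strip_game s)).
Proof.
have [k] := ubnP (inversions s); elim: k s => // k IHk s sk.
have IH c t : t \in bipass_moves c s ->
    geqv (strip_game (mirror t)) (gneg (strip_game t)).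
  by move/inversions_move => ts; apply: IHk; lia.
have to_neg c x : List.In x (map strip_game (bipass_moves c (mirror s))) ->
    exists2 y, List.In y (map (gneg \o strip_game) (bipass_moves (opposite c) s))
             & geqv x y.
  case/In_map_mem=> t /mirror_moves; rewrite mirrorK => ts ->.
  exists (gneg (strip_game (mirror t))); first by apply/In_map_mem; exists (mirror t).
  by have := IH _ _ ts; rewrite mirrorK.
have of_neg c y : List.In y (map (gneg \o strip_game) (bipass_moves (opposite c) s)) ->
    exists2 x, List.In x (map strip_game (bipass_moves c (mirror s))) & geqv x y.
  case/In_map_mem=> t ts ->; exists (strip_game (mirror t)); last exact: IH ts.
  by apply/In_map_mem; exists (mirror t); rewrite // -[c]oppositeK mirror_moves.
rewrite /geqv (strip_gameE s) (strip_gameE (mirror s)) /= -!map_comp.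
apply/andP; split; apply: gle_options => x.
- by case/(to_neg Black)=> y ? /andP[? _]; exists y.
- by case/(of_neg White)=> y ? /andP[? _]; exists y.
- by case/(of_neg Black)=> y ? /andP[_ ?]; exists y.
- by case/(to_neg White)=> y ? /andP[_ ?]; exists y.
Qed.

Lemma Delta_cat (s t : seq stone) : Delta (s ++ t) = (Delta s + Delta t)%R.
Proof. by rewrite /Delta !count_cat; lia. Qed.

Lemma Delta_nil : Delta [::] = 0%R. Proof. by []. Qed.

Lemma Delta_white (s : seq stone) : Delta (White :: s) = (1 + Delta s)%R.
Proof. by rewrite /Delta /=; lia. Qed.

Lemma Delta_black (s : seq stone) : Delta (Black :: s) = (- 1 + Delta s)%R.
Proof. by rewrite /Delta /=; lia. Qed.

Lemma Delta_nseq (k : nat) (c : stone) :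
  Delta (nseq k c) = (if c is White then k%:Z else - k%:Z)%R.
Proof. by rewrite /Delta !count_nseq; case: c => /=; lia. Qed.

Definition DeltaE := (Delta_nil, Delta_cat, Delta_white, Delta_black, Delta_nseq).

(** The first run of blacks, up to the first white stone: the part of the strip
    on which Right's replies act. *)
Lemma strip_runs (s : seq stone) : is_strip s -> s <> [::] ->
  exists p e, s = nseq p.+1 Black ++ White :: e /\ (e = [::] \/ last Black e = White).
Proof.
move=> /orP[/eqP //|/andP[/eqP hs /eqP ls]] s0.
have [p] := @drop_findK Black White s isT.
case E: (drop _ s) => [|x e] Es.
  by move: ls; rewrite Es cats0; have -> : last Black (nseq p Black) = Black by elim: (p).
have x_white := drop_find_head E; subst x.
case: p Es => [|p] Es; first by move: hs; rewrite Es.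
exists p, e; split=> //; case: e Es {E} => [|y e] Es; [by left | right].
by move: ls; rewrite Es last_cat.
Qed.

(** The stones that die after a Left move are a white prefix and a black suffix.
    The suffix has at most one stone: before the move the last stone is white,
    so the suffix is the black stone just brought to the end, and whites precede
    it. If nothing survives, those whites die as well. *)
Lemma left_move_Delta (s t : seq stone) : is_strip s -> t \in left_moves s ->
  (Delta t <= Delta s + (t != [::])%:Z)%R.
Proof.
move=> s_strip /bipass_movesP[a [m [e [Es cm Et]]]].
have [p [q Eu]] := remove_deadK (a ++ White :: m ++ Black :: e).
rewrite -{}Et in Eu.
have Du : Delta s = Delta (nseq p White ++ t ++ nseq q Black).
  by rewrite -Eu Es !DeltaE; lia.
have p_t : t = [::] -> 0 < p.
  move=> t0; move: (congr1 (count_mem White) Eu).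
  by rewrite t0 !(count_cat, count_nseq) /=; lia.
(* Delta t = Delta s - p + q, where p white stones and q black stones die. *)
suff q1 : q <= 1.
  by case: t p_t Du {Eu} => [/(_ erefl)|x t _]; rewrite !DeltaE /=; lia.
have lastB k u : last Black (u ++ nseq k.+1 Black) = Black.
  by rewrite last_cat /= ; elim: k.
case/lastP: e Es Eu => [|e x] Es Eu.
  case: q Eu {Du p_t} => [|[|q]] // /(congr1 rev).
  have m_white : m = nseq (size m) White.
    apply/all_pred1P/allP => x xm; move: cm; apply: contraR.
    by case: x xm.
  by rewrite m_white !(rev_cat, rev_cons, rev_nseq) /= -cats1 -(nseqD _ 1) addnC.
case: q Eu {Du p_t} => // q Eu; move: (lastB q (nseq p White ++ t)).
rewrite -catA -Eu !(last_cat, last_cons, last_rcons) => x_black.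
move: s_strip; rewrite Es x_black /is_strip -size_eq0 size_cat addnS /=.
by rewrite !(last_cat, last_cons, last_rcons) andbF.
Qed.

Lemma is_larvae_strip (s : seq stone) : is_larvae s -> is_strip s.
Proof.
case=> -[//|m] _ [->|->]; last by rewrite /is_strip /= last_rcons.
by rewrite /is_strip /=; elim: m.
Qed.

Lemma nseq_cat_inv (k : nat) (c : stone) (s t : seq stone) :
  nseq k c = s ++ t -> [/\ s = nseq (size s) c, t = nseq (size t) c & k = size s + size t].
Proof.
move=> E; have : all (pred1 c) (s ++ t) by rewrite -E; apply/all_pred1_nseq.
rewrite all_cat => /andP[/all_pred1P {1}-> /all_pred1P {1}->]; split=> //.
by rewrite -size_cat -E size_nseq.
Qed.

(** In B W^k Left's move either empties the strip or loses white stones; in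
    B^k W the only move kills the last black stone. *)
Lemma larvae_left_move (s t : seq stone) :
  is_larvae s -> t \in left_moves s -> t <> [::] ->
  (Delta t < Delta s)%R \/ is_larvae t /\ Delta t = (Delta s + 1)%R.
Proof.
case=> k k1 [->|->] /bipass_movesP[a [m [e [Es cm ->]]]].
  case: a Es => [[]|x a [_]] /nseq_cat_inv[m_white]; last by [].
  case=> e_white Ek /=.
  have -> : White :: m ++ Black :: e
     = nseq (size m).+1 White ++ (Black :: e) ++ nseq 0 Black.
    by rewrite cats0 /= -m_white.
  case: e e_white Ek => [_ _|x e [-> e_white] Ek].
    by rewrite (@remove_deadE _ 1 [::]).
  have De : is_larvae (Black :: White :: e).
    by exists (size (White :: e)) => //; left; rewrite {1}e_white.
  rewrite remove_deadE ?is_larvae_strip // => _.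
  by left; rewrite e_white !DeltaE /=; move: Ek => /=; lia.
case/lastP: e Es => [|e x]; last first.
  rewrite -rcons_cons -!rcons_cat -rcons_cons -rcons_cat.
  case/rcons_inj => E _; have: White \in nseq k Black.
    by rewrite E !(mem_cat, inE) eqxx !orbT.
  by rewrite mem_nseq andbF.
rewrite cats1 -rcons_cons -rcons_cat => /rcons_inj[/nseq_cat_inv[a_black [m_black] Ek]].
case: m cm m_black Ek => [|x m] cm; last by case=> xB; rewrite xB mem_head in cm.
move=> _ Ek; case: a a_black Ek => [|x a] a_black Ek //.
have t_larvae : is_larvae (rcons (x :: a) White).
  by exists (size (x :: a)) => //; right; rewrite {1}a_black.
have -> : (x :: a) ++ White :: [::] ++ [:: Black]
  = nseq 0 White ++ rcons (x :: a) White ++ nseq 1 Black by rewrite /= cat_rcons.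
rewrite remove_deadE ?is_larvae_strip // => _; right; split=> //.
by rewrite a_black -!cats1 !DeltaE Ek /=; lia.
Qed.

(** The white stone jumps over the whole first run of blacks and dies. *)
Lemma right_move_first_white (p : nat) (e : seq stone) : last Black e = White ->
  nseq p.+1 Black ++ e \in right_moves (nseq p.+1 Black ++ White :: e).
Proof.
move=> e_white; apply/bipass_movesP; exists [::], (nseq p Black), e.
split=> //; first by rewrite mem_nseq andbF.
have -> : [::] ++ White :: nseq p Black ++ Black :: e
  = nseq 1 White ++ (nseq p.+1 Black ++ e) ++ nseq 0 Black.
  by rewrite cats0 /= -cat_rcons -cats1 -(nseqD _ 1) addnC.
rewrite remove_deadE // /is_strip /= last_cat; apply/eqP.
by case: e e_white.
Qed.

(** When the only white stone is brought to the front everything dies; when it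
    stops behind the first black stone the strip BW is left. Both results have
    Delta 0, but only the second one is live. *)
Lemma right_move_single_white (p : nat) :
  [::] \in right_moves (nseq p.+1 Black ++ [:: White]) /\
  [:: Black; White] \in right_moves (nseq p.+2 Black ++ [:: White]).
Proof.
split; apply/bipass_movesP.
  exists [::], (nseq p Black), [::]; split=> //; first by rewrite mem_nseq andbF.
  rewrite (_ : _ ++ _ = nseq 1 White ++ [::] ++ nseq p.+1 Black) ?remove_deadE //.
  by rewrite /= -(nseqD _ 1) addnC.
exists [:: Black], (nseq p Black), [::]; split=> //; first by rewrite mem_nseq andbF.
rewrite (_ : _ ++ _ = nseq 0 White ++ [:: Black; White] ++ nseq p.+1 Black).
  by rewrite remove_deadE.
by rewrite /= -(nseqD _ 1) addnC.
Qed.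

(** * Sums of strips *)

Definition position_game (l : seq (seq stone)) : game :=
  \big[gadd/gzero]_(s <- l) strip_game s.

Definition total_Delta (l : seq (seq stone)) : int := (\sum_(s <- l) Delta s)%R.

Definition live (l : seq (seq stone)) : nat := count (fun s => s != [::]) l.

Definition all_larvae (l : seq (seq stone)) : Prop :=
  forall s, s \in l -> s <> [::] -> is_larvae s.

Lemma position_game_cat (l l' : seq (seq stone)) :
  position_game (l ++ l') = gadd (position_game l) (position_game l').
Proof. exact: big_cat. Qed.

Lemma total_Delta_cat_cons (l1 l2 : seq (seq stone)) (s : seq stone) :
  total_Delta (l1 ++ s :: l2) = (total_Delta (l1 ++ l2) + Delta s)%R.
Proof. by rewrite /total_Delta !big_cat big_cons /=; lia. Qed.

Lemma live_cat_cons (l1 l2 : seq (seq stone)) (s : seq stone) :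
  live (l1 ++ s :: l2) = live (l1 ++ l2) + (s != [::]).
Proof. by rewrite /live !count_cat /=; lia. Qed.

(** Emptied strips stay in the list, so that a move always replaces one entry
    and keeps the others in place. *)
Lemma position_moves (l : seq (seq stone)) (x : game) :
  (List.In x (left_options (position_game l)) <->
   exists l1 s t l2, [/\ l = l1 ++ s :: l2, t \in left_moves s
                       & x = position_game (l1 ++ t :: l2)]) /\
  (List.In x (right_options (position_game l)) <->
   exists l1 s t l2, [/\ l = l1 ++ s :: l2, t \in right_moves s
                       & x = position_game (l1 ++ t :: l2)]).
Proof.
elim: l x => [|s l IHl] x.
  by rewrite /position_game big_nil /=; do !split=> //; case=> -[|? ?] [? [? [? []]]].
rewrite {1 3}/position_game big_cons -/(position_game l).
have [sL sR]: left_options (strip_game s) = map strip_game (left_moves s) /\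
              right_options (strip_game s) = map strip_game (right_moves s).
  by rewrite strip_gameE.
rewrite In_left_optionsD In_right_optionsD sL sR /position_game.
have IHL y := (IHl y).1; have IHR y := (IHl y).2; split; split.
- case=> [[_ /In_map_mem[t ts ->] ->]|[y /IHL[l1 [s1 [t [l2 [-> ts ->]]]]] ->]].
    by exists [::], s, t, l; rewrite big_cons.
  by exists (s :: l1), s1, t, l2; rewrite big_cons.
- case=> -[|s1 l1] [s2 [t [l2 []]]] [Es El] ts ->; rewrite big_cons.
    by left; exists (strip_game t); rewrite ?El //; apply/In_map_mem; exists t; rewrite ?Es.
  right; exists (position_game (l1 ++ t :: l2)); last by rewrite Es.
  by apply/IHL; exists l1, s2, t, l2.
- case=> [[_ /In_map_mem[t ts ->] ->]|[y /IHR[l1 [s1 [t [l2 [-> ts ->]]]]] ->]].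
    by exists [::], s, t, l; rewrite big_cons.
  by exists (s :: l1), s1, t, l2; rewrite big_cons.
- case=> -[|s1 l1] [s2 [t [l2 []]]] [Es El] ts ->; rewrite big_cons.
    by left; exists (strip_game t); rewrite ?El //; apply/In_map_mem; exists t; rewrite ?Es.
  right; exists (position_game (l1 ++ t :: l2)); last by rewrite Es.
  by apply/IHR; exists l1, s2, t, l2.
Qed.

Lemma position_game_mirror (l : seq (seq stone)) :
  geqv (position_game (map mirror l)) (gneg (position_game l)).
Proof.
rewrite /position_game; elim: l => [|s l IHl]; first by rewrite !big_nil.
by rewrite /= !big_cons gneg_add; apply: geqv_add (strip_game_mirror s) IHl.
Qed.

(** * Strategies *)

Lemma total_Delta_le0 (l : seq (seq stone)) :
  (forall s, s \in l -> Delta s <= 0)%R -> (total_Delta l <= 0)%R.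
Proof. by move=> le0; rewrite /total_Delta big_seq; apply: sumr_le0 => s /le0. Qed.

Lemma total_Delta_ge0 (l : seq (seq stone)) :
  (forall s, s \in l -> 0 <= Delta s)%R -> (0 <= total_Delta l)%R.
Proof. by move=> ge0; rewrite /total_Delta big_seq; apply: sumr_ge0 => s /ge0. Qed.

(** The two invariants of Right's strategy, with Left and with Right to move.
    The second alternatives are reached when Right's replies reduce the position
    to an even number of larvae of total Delta 0. *)
Definition favours_right_second (l : seq (seq stone)) : Prop :=
  (total_Delta l + 1 < (odd (live l))%:Z)%R \/
  [/\ all_larvae l, ~~ odd (live l) & total_Delta l = 0%R].

Definition favours_right_first (l : seq (seq stone)) : Prop :=
  (total_Delta l < (odd (live l))%:Z)%R \/
  [/\ all_larvae l, ~~ odd (live l) & total_Delta l = 1%R].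

Lemma all_larvae_replace (l1 l2 : seq (seq stone)) (s t : seq stone) :
  all_larvae (l1 ++ s :: l2) -> (t <> [::] -> is_larvae t) ->
  all_larvae (l1 ++ t :: l2).
Proof.
move=> larv lt u; rewrite mem_cat inE => /or3P[ul|/eqP ->|ul] u0; last 2 [exact: lt].
  by apply: larv => //; rewrite mem_cat ul.
by apply: larv => //; rewrite mem_cat inE ul !orbT.
Qed.

(** The parity of the number of live strips changes only if Left empties a
    strip, and then Delta does not grow. Otherwise Delta grows by at most one,
    which is the difference between the two conditions; among larvae with total
    Delta 0 a growth leads to the second alternative. *)
Lemma after_left_move (l1 l2 : seq (seq stone)) (s t : seq stone) :
  all is_strip (l1 ++ s :: l2) -> t \in left_moves s ->
  favours_right_second (l1 ++ s :: l2) -> favours_right_first (l1 ++ t :: l2).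
Proof.
rewrite all_cat /= => /and3P[_ s_strip _] ts.
have s0 : s <> [::] by move=> s0; rewrite s0 in ts.
have := left_move_Delta s_strip ts.
rewrite /favours_right_second /favours_right_first.
rewrite !total_Delta_cat_cons !live_cat_cons (introN eqP s0).
case: (t =P [::]) => t0 /= Dt [lt|[larv ev D0]]; try by left; lia.
have s_larvae : is_larvae s by apply: larv => //; rewrite mem_cat mem_head orbT.
have [lt|[t_larvae Dst]] := larvae_left_move s_larvae ts t0; first by left; lia.
right; split; [|lia|lia].
exact: all_larvae_replace larv _.
Qed.

Lemma mem_split (l : seq (seq stone)) (s : seq stone) :
  s \in l -> exists l1 l2, l = l1 ++ s :: l2.
Proof. by case/splitPr=> l1 l2; exists l1, l2. Qed.

Lemma larvae_runs (s : seq stone) : is_larvae s ->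
  exists p e, s = nseq p.+1 Black ++ White :: e /\
   (e = [::] \/ p = 0 /\ e = nseq (size e) White).
Proof.
case=> -[//|m] _ [->|->]; last by exists m, [::]; rewrite cats1; split; last left.
exists 0, (nseq m White); by split=> //; right; rewrite size_nseq.
Qed.

(** Right's strategy: in a position of larvae with total Delta 1 shorten some
    B W^k with k at least 2; otherwise use up a white stone of a strip that has
    two of them; otherwise all live strips are B^m W, and replacing one with m at
    least 2 by BW or by nothing gives the same total Delta, with the parity of
    choice; if all are BW, their number is odd and one of them is removed. *)
Lemma right_has_good_move (l : seq (seq stone)) :
  all is_strip l -> favours_right_first l ->
  exists l1 s t l2, [/\ l = l1 ++ s :: l2, t \in right_moves s
                      & favours_right_second (l1 ++ t :: l2)].
Proof.
move=> strips [Dlt|[larv ev D1]]; last first.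
  have [s sl Ds] : exists2 s, s \in l & (0 < Delta s)%R.
    suff /hasP[s sl ?]: has (fun s => 0 < Delta s)%R l by exists s.
    apply: contra_eqT D1 => /hasPn le0; rewrite lt_eqF //.
    by apply: le_lt_trans (total_Delta_le0 _) _ => // s /le0; rewrite -leNgt.
  have [l1 [l2 El]] := mem_split sl.
  have s0 : s <> [::] by move=> s0; rewrite s0 in Ds.
  have s_larvae := larv s sl s0.
  have [p [e [Es [e0|[p0 e_white]]]]] := larvae_runs s_larvae.
    by move: Ds; rewrite Es e0 !DeltaE; lia.
  case: e e_white Es => [|x e] e_white Es.
    by move: Ds; rewrite Es p0 !DeltaE; lia.
  exists l1, s, (nseq p.+1 Black ++ x :: e), l2; split=> //.
    rewrite Es; apply: right_move_first_white.
    by case: e_white => -> -> /=; elim: (size e).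
  right; split.
  - rewrite El in larv; apply: all_larvae_replace larv _ => _.
    by exists (size (x :: e)) => //; left; rewrite p0 {1}e_white.
  - by move: ev; rewrite El Es p0 !live_cat_cons.
  - by move: D1; rewrite El Es !total_Delta_cat_cons !DeltaE; lia.
case: (boolP (has (fun s => 1 < count_mem White s) l)) => [/hasP[s sl s2]|].
  have [l1 [l2 El]] := mem_split sl.
  have s_strip := allP strips s sl.
  have s0 : s <> [::] by move=> s0; rewrite s0 in s2.
  have [p [e [Es [e0|e_white]]]] := strip_runs s_strip s0.
    by move: s2; rewrite Es e0 count_cat count_nseq.
  exists l1, s, (nseq p.+1 Black ++ e), l2; split=> //.
    by rewrite Es; apply: right_move_first_white.
  left; move: Dlt; rewrite El Es !total_Delta_cat_cons !live_cat_cons !DeltaE /=.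
  by lia.
move/hasPn => one_white.
have shape s : s \in l -> s <> [::] -> exists p, s = nseq p.+1 Black ++ [:: White].
  move=> sl s0; have [p [e [Es [e0|e_white]]]] := strip_runs (allP strips s sl) s0.
    by exists p; rewrite Es e0.
  have e_pos : 0 < count_mem White e.
    rewrite -has_count has_pred1; case: e e_white {Es} => // x e /= <-.
    exact: mem_last.
  by have := one_white s sl; rewrite Es count_cat count_nseq /= mul0n !add0n add1n ltnS e_pos.
have larv : all_larvae l.
  by move=> s sl s0; have [p ->] := shape s sl s0; exists p.+1 => //; right; rewrite cats1.
have nonpos s : s \in l -> (Delta s <= 0)%R.
  move=> sl; case: (s =P [::]) => [-> //|s0].
  by have [p ->] := shape s sl s0; rewrite !DeltaE /=; lia.
(* With D < 0 the strip to change must have at least two blacks, for then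
   both BW and the empty strip can be reached. With D = 0 all live strips are BW,
   and emptying one makes their odd number even. *)
have [s [sl s0 Ds]] : exists s, [/\ s \in l, s <> [::] &
   (total_Delta l < 0 -> Delta s < 0)%R].
  case: (boolP (has (fun s => Delta s < 0)%R l)) => [/hasP[s sl Ds]|/hasPn ge0].
    by exists s; split=> // s0; rewrite s0 in Ds.
  have D0 : (0 <= total_Delta l)%R.
    by apply: total_Delta_ge0 => s /ge0; rewrite -leNgt.
  have : 0 < live l by case: (live l) Dlt => //=; lia.
  by rewrite -has_count => /hasP[s sl /eqP s0]; exists s; split=> //; lia.
have [l1 [l2 El]] := mem_split sl.
have le0 : (total_Delta (l1 ++ l2) <= 0)%R.
  apply: total_Delta_le0 => u ul; apply: nonpos.
  by move: ul; rewrite El !mem_cat inE orbCA => ->; rewrite orbT.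
have [p Es] := shape s sl s0.
have [to0 _] := right_move_single_white p.
have larv_t t : is_larvae t \/ t = [::] -> all_larvae (l1 ++ t :: l2).
  by rewrite El in larv => tP; apply: all_larvae_replace larv _ => t0; case: tP.
have Dsp : Delta s = (- p%:Z)%R by rewrite Es !DeltaE /=; lia.
have D0 : Delta [::] = 0%R by [].
have DBW : Delta [:: Black; White] = 0%R by [].
have BW_larvae : is_larvae [:: Black; White] by exists 1 => //; left.
move: Dlt Ds; rewrite El total_Delta_cat_cons live_cat_cons (introN eqP s0) Dsp.
move=> Dlt Ds.
rewrite addn1 /= in Dlt.
(* The rest, of total Delta D', should be completed to an even number of
   live strips if D' = 0 and to an odd number if D' < 0. *)
have [good_parity|bad_parity] := boolP (odd (live (l1 ++ l2)) (+) (total_Delta (l1 ++ l2) == 0%R)).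
  exists l1, s, [::], l2; split; rewrite ?Es // /favours_right_second.
  rewrite total_Delta_cat_cons live_cat_cons D0 addn0 addr0.
  case: eqP good_parity => D'; rewrite ?addbT ?addbF => par.
    by right; split=> //; apply: larv_t; right.
  by left; rewrite par; lia.
case: p Es Dsp Dlt Ds to0 => [|p] Es Dsp Dlt Ds _.
  exfalso; move: bad_parity Dlt Ds; case: eqP => D'; case: odd => //=; lia.
have [_ to1] := right_move_single_white p.
exists l1, s, [:: Black; White], l2; split; rewrite ?Es // /favours_right_second.
rewrite total_Delta_cat_cons live_cat_cons DBW addn1 addr0 /=.
case: eqP bad_parity => D'; rewrite ?addbT ?addbF => par.
  by right; split=> //; apply: larv_t; left.
by left; rewrite par; lia.
Qed.

Definition total_inversions (l : seq (seq stone)) : nat := \sum_(s <- l) inversions s.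

Lemma right_wins_favourable (l : seq (seq stone)) : all is_strip l ->
  (favours_right_second l -> gle (position_game l) gzero) /\
  (favours_right_first l -> ~~ gle gzero (position_game l)).
Proof.
have [k] := ubnP (total_inversions l); elim: k l => // k IHk l lk strips.
have smaller c l1 s t l2 : l = l1 ++ s :: l2 -> t \in bipass_moves c s ->
    total_inversions (l1 ++ t :: l2) < k /\ all is_strip (l1 ++ t :: l2).
  move=> El ts; split.
    have := inversions_move ts.
    by move: lk; rewrite El /total_inversions !big_cat !big_cons /=; lia.
  move: strips ts; rewrite El !all_cat /= => /and3P[-> _ ->].
  by case/allpairsPdep=> i [j [_ _ ->]]; rewrite remove_dead_strip.
split=> win.
  apply/gleP; split=> // x /(position_moves l x).1 [l1 [s [t [l2 [El ts ->]]]]].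
  have [lt strips'] := smaller _ _ _ _ _ El ts.
  by apply: (IHk _ lt strips').2; apply: (after_left_move _ ts); rewrite -El.
have [l1 [s [t [l2 [El ts win']]]]] := right_has_good_move strips win.
have [lt strips'] := smaller _ _ _ _ _ El ts.
apply/negP => /gleP[_ /(_ (position_game (l1 ++ t :: l2)))].
rewrite (IHk _ lt strips').1 // => /(_ _)/negP[] //.
by apply/(position_moves l _).2; exists l1, s, t, l2.
Qed.

(** * Reflected strategies and comparisons *)

Lemma all_is_strip_mirror (l : seq (seq stone)) :
  all is_strip l -> all is_strip (map mirror l).
Proof. by rewrite all_map; apply: sub_all => s; apply: mirror_is_strip. Qed.

Lemma total_Delta_mirror (l : seq (seq stone)) :
  total_Delta (map mirror l) = (- total_Delta l)%R.
Proof.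
rewrite /total_Delta big_map -sumrN; apply: eq_bigr => s _.
exact: Delta_mirror.
Qed.

Lemma live_mirror (l : seq (seq stone)) : live (map mirror l) = live l.
Proof. by rewrite /live count_map; apply: eq_count => s /=; rewrite mirror_nilE. Qed.

Lemma all_larvae_mirror (l : seq (seq stone)) :
  all_larvae l -> all_larvae (map mirror l).
Proof.
move=> larv _ /mapP[s sl ->] /eqP; rewrite mirror_nilE => /eqP s0.
exact/mirror_larvae/larv.
Qed.

(** Reflection negates a position, hence it carries Right's strategies over to
    Left. *)
Lemma left_wins_mirror_favourable (l : seq (seq stone)) : all is_strip l ->
  (favours_right_second (map mirror l) -> gle gzero (position_game l)) /\
  (favours_right_first (map mirror l) -> ~~ gle (position_game l) gzero).
Proof.
move/all_is_strip_mirror/right_wins_favourable.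
have [-> ->] := geqv_gle0 (position_game_mirror l).
by have [-> ->] := gle_neg0 (position_game l).
Qed.

(** The larvae alternative of the invariant holds for the reflected position
    too, so neither player wins moving first. *)
Lemma larvae_cancel (l : seq (seq stone)) :
  all is_strip l -> all_larvae l -> ~~ odd (live l) -> total_Delta l = 0%R ->
  geqv (position_game l) gzero.
Proof.
move=> strips larv ev D0; apply/andP; split.
  by apply: (right_wins_favourable strips).1; right.
apply: (left_wins_mirror_favourable strips).1; right.
by rewrite live_mirror total_Delta_mirror D0 oppr0; split=> //; apply: all_larvae_mirror.
Qed.

(** One more BW, which is its own negative, makes an even number of larvae. *)
Lemma odd_stars (n : nat) : odd n -> geqv (position_game (nseq n [:: Black; White])) gstar.
Proof.
move=> n_odd; set m := nseq n _; have [le_sub ge_sub] := gle_sub (position_game m) gstar.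
have BW_star : position_game [:: [:: Black; White]] = gneg gstar.
  by rewrite /position_game !(big_cons, big_nil).
rewrite -BW_star -position_game_cat in le_sub ge_sub.
rewrite /geqv -le_sub -ge_sub -(nseqD n 1).
apply: larvae_cancel.
- by rewrite all_nseq orbT.
- by move=> s; rewrite mem_nseq => /andP[_ /eqP ->] _; exists 1 => //; left.
- by rewrite /live count_nseq mul1n addn1 /= negbK.
- by rewrite /total_Delta big_nseq; elim: (n + 1) => //= k ->.
Qed.

(** If the strips k represent - K, comparing l with K is playing l and k
    together. *)
Lemma position_compare (K : game) (l k : seq (seq stone)) :
  all is_strip (l ++ k) -> geqv (gneg K) (position_game k) ->
  [/\ favours_right_second (l ++ k) -> gle (position_game l) K,
      favours_right_first (l ++ k) -> ~~ gle K (position_game l),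
      favours_right_second (map mirror (l ++ k)) -> gle K (position_game l)
    & favours_right_first (map mirror (l ++ k)) -> ~~ gle (position_game l) K].
Proof.
move=> strips negK; have [] := gle_sub (position_game l) K.
have [-> ->] : gle (gadd (position_game l) (gneg K)) gzero
      = gle (position_game (l ++ k)) gzero /\
    gle gzero (gadd (position_game l) (gneg K)) = gle gzero (position_game (l ++ k)).
  rewrite position_game_cat; apply: geqv_gle0; apply: geqv_add negK.
  by rewrite /geqv gle_refl.
by move=> <- <-; have [] := right_wins_favourable strips; have [] := left_wins_mirror_favourable strips.
Qed.

(** This makes a sum of copies of * a sum of strips. *)
Lemma strip_game_BW : strip_game [:: Black; White] = gstar.
Proof. by []. Qed.

Lemma total_Delta_cat (l k : seq (seq stone)) :
  total_Delta (l ++ k) = (total_Delta l + total_Delta k)%R.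
Proof. exact: big_cat. Qed.

Lemma live_cat (l k : seq (seq stone)) : live (l ++ k) = live l + live k.
Proof. exact: count_cat. Qed.

Lemma position_game_geqv (I : Type) (r : seq I) (s t : I -> seq stone) :
  (forall i, geqv (strip_game (s i)) (strip_game (t i))) ->
  geqv (position_game (map s r)) (position_game (map t r)).
Proof.
move=> st; rewrite /position_game !big_map; elim: r => [|i r IHr].
  by rewrite !big_nil.
by rewrite !big_cons; apply: geqv_add.
Qed.

Theorem theorem15 (n : nat) (s : 'I_n -> seq stone)
    (s_strip : forall i : 'I_n, is_strip (s i))
    (s_nonempty : forall i : 'I_n, s i <> [::])
    (Delta0 : (\sum_(i < n) Delta (s i))%R = 0%R) :
  let g := gsum (fun i : 'I_n => strip_game (s i)) in
  (odd n ->
     [/\ gfuzzy g gzero /\ first_player_wins g,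
         (forall i : 'I_n, geqv (strip_game (s i)) gstar) -> geqv g gstar,
         glt (gadd gdown gstar) g /\ glt g (gadd gup gstar)
       & glt_fuzzy gdown g /\ glt_fuzzy g gup])
  /\
  (~~ odd n ->
     [/\ gfuzzy g gstar,
         (forall i : 'I_n, is_larvae (s i)) -> geqv g gzero,
         glt gdown g /\ glt g gup
       & glt_fuzzy (gadd gdown gstar) g /\ glt_fuzzy g (gadd gup gstar)]).
Proof.
have enumE : index_enum 'I_n = enum 'I_n by rewrite [LHS]unlock -enumT.
pose l := map s (enum 'I_n).
have -> : gsum (fun i => strip_game (s i)) = position_game l.
  by rewrite /gsum /position_game big_map enumE.
have l_live : live l = n.
  rewrite /live count_map -[RHS](size_enum_ord n) -count_predT.
  by apply: eq_count => i; apply/eqP/s_nonempty.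
have l_strip : all is_strip l by rewrite all_map; apply/allP => i _ /=.
have l_Delta : total_Delta l = 0%R by rewrite /total_Delta big_map -enumE.
(* For all six games K of the theorem - K is a sum k of strips, and l has total
   Delta 0, so the invariants of l and k together are read off from k and n. *)
have compare (K : game) (k : seq (seq stone)) (d : int) :
    geqv (gneg K) (position_game k) -> all is_strip k -> total_Delta k = d ->
  [/\ (d + 1 < (odd (n + live k))%:Z)%R -> gle (position_game l) K,
      (d < (odd (n + live k))%:Z)%R -> ~~ gle K (position_game l),
      (- d + 1 < (odd (n + live k))%:Z)%R -> gle K (position_game l)
    & (- d < (odd (n + live k))%:Z)%R -> ~~ gle (position_game l) K].
  move=> Kk k_strip <-.
  have lk_strip : all is_strip (l ++ k) by rewrite all_cat l_strip.
  have lk_Delta : total_Delta (l ++ k) = total_Delta k.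
    by rewrite total_Delta_cat l_Delta add0r.
  have [c1 c2 c3 c4] := position_compare lk_strip Kk.
  by split=> lt; [apply: c1 | apply: c2 | apply: c3 | apply: c4]; left;
    rewrite ?total_Delta_mirror ?live_mirror lk_Delta live_cat l_live.
pose posE := (big_cons, big_nil).
have [| | |_ zero2 _ zero4] := compare gzero [::] 0%R.
- by rewrite /position_game !posE.
- by [].
- by rewrite /total_Delta !posE.
have [| | |_ star2 _ star4] := compare gstar [:: [:: Black; White]] 0%R.
- by rewrite /position_game !posE.
- by [].
- by rewrite /total_Delta !posE.
have [| | |up1 up2 _ _] := compare gup [:: [:: Black; Black; White]] (-1)%R.
- by rewrite /position_game !posE.
- by [].
- by rewrite /total_Delta !posE.
have [| | |ups1 ups2 _ _] :=
  compare (gadd gup gstar) [:: [:: Black; Black; White]; [:: Black; White]] (-1)%R.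
- by rewrite /position_game !posE.
- by [].
- by rewrite /total_Delta !posE.
have [| | |_ _ dn3 dn4] := compare gdown [:: [:: Black; White; White]] 1%R.
- by rewrite /position_game !posE.
- by [].
- by rewrite /total_Delta !posE.
have [| | |_ _ dns3 dns4] :=
  compare (gadd gdown gstar) [:: [:: Black; White; White]; [:: Black; White]] 1%R.
- by rewrite /position_game !posE.
- by [].
- by rewrite /total_Delta !posE.
move: zero2 zero4 star2 star4 up1 up2 ups1 ups2 dn3 dn4 dns3 dns4.
rewrite /live /= addn0 addn1 addn2 /= negbK.
case n_odd: (odd n) => /= zero2 zero4 star2 star4 up1 up2 ups1 ups2 dn3 dn4 dns3 dns4.
  split=> // _; split.
  - by rewrite /gfuzzy /first_player_wins wins_firstE /= zero2 ?zero4.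
  - move=> s_star; apply: (geqv_trans _ (odd_stars n_odd)).
    have -> : nseq n [:: Black; White] = map (fun=> [:: Black; White]) (enum 'I_n).
      by rewrite -[in LHS](size_enum_ord n); elim: (enum _) => //= _ r ->.
    by apply: position_game_geqv => i; rewrite strip_game_BW.
  - by rewrite /glt dns3 ?dns4 ?ups1 ?ups2.
  - by rewrite !glt_fuzzyE dn4 ?up2.
split=> // _; split.
- by rewrite /gfuzzy star4 ?star2.
- move=> larv; apply: larvae_cancel; rewrite ?l_live ?n_odd //.
  by move=> _ /mapP[i _ ->] _.
- by rewrite /glt dn3 ?dn4 ?up1 ?up2.
- by rewrite !glt_fuzzyE dns4 ?ups2.
Qed.
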